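(* Let $T\cup\{\varphi\}$ be a set of formulas of the language $\mathcal{L}(\mathrm{RPL})$. Then $T\vdash_{\mathrm{RPL}}\varphi$ if and only if $\{\langle 1,\psi\rangle\mid\psi\in T\}\vdash_{\mathrm{GRPL}}\langle 1,\varphi\rangle$.
   Context: Language. Formulas are built from propositional variables and a constant $\overline{q}$ for each rational $q\in[0,1]$, using the basic connectives $\neg$ (unary) and $\to$ (binary); call this language $\mathcal{L}(\mathrm{RPL})$. Abbreviations: $\alpha\oplus\beta$ is $\neg\alpha\to\beta$; $\alpha\odot\beta$ is $\neg(\neg\alpha\oplus\neg\beta)$; $\alpha\wedge\beta$ is $\alpha\odot(\alpha\to\beta)$; $\alpha\equiv\beta$ is $(\alpha\to\beta)\wedge(\beta\to\alpha)$; $1$ is $p_0\to p_0$ for a fixed variable $p_0$, and $0$ is $\neg 1$. Operations on rationals in $[0,1]$: $q\to^{Ł}r=\min(1,1-q+r)$, $\neg^{Ł}q=1-q$, $q\odot^{Ł}r=\max(0,q+r-1)$. Łukasiewicz axiom schemata (instances are taken over $\mathcal{L}(\mathrm{RPL})$): (A1) $\varphi\to(\psi\to\varphi)$; (A2) $(\varphi\to\psi)\to((\psi\to\chi)\to(\varphi\to\chi))$; (A3) $((\varphi\to\psi)\to\psi)\to((\psi\to\varphi)\to\varphi)$; (A4) $(\neg\varphi\to\neg\psi)\to(\psi\to\varphi)$. Rational Pavelka logic RPL. Axioms: all instances of (A1)–(A4) and the bookkeeping axioms $(\overline{q}\to\overline{r})\equiv\overline{q\to^{Ł}r}$, $\neg\overline{q}\equiv\overline{\neg^{Ł}q}$,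 $\overline{1}\equiv 1$, $\overline{0}\equiv 0$, for all rationals $q,r\in[0,1]$. The only rule is modus ponens: from $\varphi$ and $\varphi\to\psi$ infer $\psi$. For a set $S\cup\{\varphi\}$ of formulas, $S\vdash_{\mathrm{RPL}}\varphi$ means there is a finite sequence of formulas ending in $\varphi$, each of which is an axiom, an element of $S$, or follows from earlier elements by modus ponens. Graded Rational Pavelka logic GRPL. A graded formula is a pair $\langle r,\varphi\rangle$ with $r\in[0,1]$ rational (the grade) and $\varphi$ a formula of $\mathcal{L}(\mathrm{RPL})$. Axioms of GRPL: (A) $\langle 1,\alpha\rangle$ for each instance $\alpha$ of (A1)–(A4); (B) $\langle q,\overline{q}\rangle$ for each rational $q\in[0,1]$; (C) $\langle 1,\neg\overline{q}\equiv\overline{\neg^{Ł}q}\rangle$ and $\langle 1,(\overline{q}\to\overline{r})\equiv\overline{q\to^{Ł}r}\rangle$ for all rationals $q,r\in[0,1]$; (D) $\langle 0,\varphi\rangle$ for every other formula $\varphi$ of $\mathcal{L}(\mathrm{RPL})$. Rules, for all rationals $q,r\in[0,1]$: graded modus ponens: from $\langle q,\varphi\rangle$ and $\langle r,\varphi\to\psi\rangle$ infer $\langle q\odot^{Ł}r,\psi\rangle$; lifting: from $\langle q,\varphi\rangle$ infer $\langle r\to^{Ł}q,\overline{r}\to\varphi\rangle$. For a set $T$ of graded formulas, a GRPL-proof from $T$ is a finite sequence of graded formulas each of which is an axiom of GRPL, an element of $T$, or follows from earlier elements by one of the two rules; $T\vdash_{\mathrm{GRPL}}\langle q,\varphi\rangle$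 means that $\langle q,\varphi\rangle$ is the last element of some GRPL-proof from $T$. *)

(* Defs.v *)
From Stdlib Require List.
From mathcomp Require Import all_boot all_order all_algebra.
From mathcomp Require Import classical_sets.
From mathcomp Require Import lra.

Set Implicit Arguments.
Unset Strict Implicit.
Unset Printing Implicit Defensive.

Import Order.TTheory GRing.Theory Num.Theory.
Local Open Scope ring_scope.
Local Open Scope classical_set_scope.

Definition urat : Type := {q : rat | 0 <= q <= 1}.
Definition mk_urat (q : rat) (q01 : 0 <= q <= 1) : urat := exist _ q q01.

Fact urat0_subproof : 0 <= (0 : rat) <= 1. Proof. by []. Qed.
Fact urat1_subproof : 0 <= (1 : rat) <= 1. Proof. by []. Qed.
Definition urat0 : urat := mk_urat urat0_subproof.
Definition urat1 : urat := mk_urat urat1_subproof.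

Fact luk_imp_subproof (q r : urat) :
  0 <= Num.min 1 (1 - val q + val r) <= 1.
Proof.
case: q r => [q /= /andP[q0 q1]] [r /= /andP[r0 r1]].
by rewrite le_min ge_min ler01 lexx /= andbT; lra.
Qed.
Definition luk_imp (q r : urat) : urat := mk_urat (luk_imp_subproof q r).

Fact luk_neg_subproof (q : urat) : 0 <= 1 - val q <= 1.
Proof. by case: q => [q /= /andP[q0 q1]]; lra. Qed.
Definition luk_neg (q : urat) : urat := mk_urat (luk_neg_subproof q).

Fact luk_conj_subproof (q r : urat) :
  0 <= Num.max 0 (val q + val r - 1) <= 1.
Proof.
case: q r => [q /= /andP[q0 q1]] [r /= /andP[r0 r1]].
by rewrite le_max ge_max ler01 lexx /=; lra.
Qed.
Definition luk_conj (q r : urat) : urat := mk_urat (luk_conj_subproof q r).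

Inductive form : Type :=
| Var of nat
| Const of urat
| Neg of form
| Imp of form & form.

Definition Oplus (a b : form) : form := Imp (Neg a) b.
Definition Odot (a b : form) : form := Neg (Oplus (Neg a) (Neg b)).
Definition And (a b : form) : form := Odot a (Imp a b).
Definition Equ (a b : form) : form := And (Imp a b) (Imp b a).
(* [One] and [Zero] are abbreviations in the connectives alone, syntactically
   distinct from the truth constants [Const urat1] and [Const urat0]. *)
Definition One : form := Imp (Var 0) (Var 0).
Definition Zero : form := Neg One.

Inductive luk_axiom : form -> Prop :=
| A1 p q : luk_axiom (Imp p (Imp q p))
| A2 p q r : luk_axiom (Imp (Imp p q) (Imp (Imp q r) (Imp p r)))
| A3 p q : luk_axiom (Imp (Imp (Imp p q) q) (Imp (Imp q p) p))
| A4 p q : luk_axiom (Imp (Imp (Neg p) (Neg q)) (Imp q p)).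

(* [step prev x]: the entry [x] is admissible after the list [prev] of all
   earlier entries. *)
Definition is_proof (X : Type) (step : seq X -> X -> Prop) (s : seq X) : Prop :=
  forall s1 x s2, s = s1 ++ x :: s2 -> step s1 x.

Definition provable (X : Type) (step : seq X -> X -> Prop) (x : X) : Prop :=
  exists s : seq X, is_proof step (rcons s x).

Inductive rpl_axiom : form -> Prop :=
| RPL_luk a : luk_axiom a -> rpl_axiom a
| RPL_imp q r :
    rpl_axiom (Equ (Imp (Const q) (Const r)) (Const (luk_imp q r)))
| RPL_neg q : rpl_axiom (Equ (Neg (Const q)) (Const (luk_neg q)))
| RPL_one : rpl_axiom (Equ (Const urat1) One)
| RPL_zero : rpl_axiom (Equ (Const urat0) Zero).

Inductive rpl_step (S : set form) (prev : seq form) : form -> Prop :=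
| RPL_ax a : rpl_axiom a -> rpl_step S prev a
| RPL_hyp a : S a -> rpl_step S prev a
| RPL_mp a b :
    List.In a prev -> List.In (Imp a b) prev -> rpl_step S prev b.

Definition rpl_provable (S : set form) (a : form) : Prop :=
  provable (rpl_step S) a.

Definition gform : Type := (urat * form)%type.

Inductive grpl_axiom_ABC : gform -> Prop :=
| GRPL_A a : luk_axiom a -> grpl_axiom_ABC (urat1, a)
| GRPL_B q : grpl_axiom_ABC (q, Const q)
| GRPL_C_neg q :
    grpl_axiom_ABC (urat1, Equ (Neg (Const q)) (Const (luk_neg q)))
| GRPL_C_imp q r :
    grpl_axiom_ABC
      (urat1, Equ (Imp (Const q) (Const r)) (Const (luk_imp q r))).

Inductive grpl_axiom : gform -> Prop :=
| GRPL_ABC g : grpl_axiom_ABC g -> grpl_axiom g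
| GRPL_D a : (forall q, ~ grpl_axiom_ABC (q, a)) -> grpl_axiom (urat0, a).

Inductive grpl_step (T : set gform) (prev : seq gform) : gform -> Prop :=
| GRPL_ax g : grpl_axiom g -> grpl_step T prev g
| GRPL_hyp g : T g -> grpl_step T prev g
| GRPL_mp q r a b :
    List.In (q, a) prev -> List.In (r, Imp a b) prev ->
    grpl_step T prev (luk_conj q r, b)
| GRPL_lift q r a :
    List.In (q, a) prev ->
    grpl_step T prev (luk_imp r q, Imp (Const r) a).

Definition grpl_provable (T : set gform) (g : gform) : Prop :=
  provable (grpl_step T) g.

(* Main.v *)
(** From RPL to GRPL, the formulas provable with grade 1 contain the
    Łukasiewicz axioms and are closed under modus ponens, so only the
    bookkeeping axioms for 0 and 1 need an argument.  Conversely, every entry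
    <q, a> of a GRPL-proof satisfies T |-RPL q -> a: graded modus ponens becomes
    residuation, once the constant for the conjunction of q and r is identified
    with ~(q -> ~r), and lifting becomes prefixing. *)
Require Import Defs.
From mathcomp Require Import all_boot classical_sets.
From mathcomp Require Import order ssralg ssrnum rat lra.

Set Implicit Arguments.
Unset Strict Implicit.
Unset Printing Implicit Defensive.

Import Order.TTheory GRing.Theory Num.Theory.
Local Open Scope classical_set_scope.

(** * Proofs as finite sequences over an arbitrary step relation *)

Section SequenceProofs.
Variables (X : Type) (step : seq X -> X -> Prop).

(** Steps survive when more earlier entries become available, which is what allows proofs to be
    concatenated. *)
Definition step_mono := forall s1 s2 x,
  (forall y, List.In y s1 -> List.In y s2) -> step s1 x -> step s2 x.

Lemma is_proof_rcons s x :
  is_proof step (rcons s x) <-> is_proof step s /\ step s x.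
Proof.
split=> [Hs | [Hs Hx] s1 y s2].
  split=> [s1 y s2 Es|]; first by apply: (Hs _ _ (rcons s2 x)); rewrite Es rcons_cat.
  by apply: (Hs _ _ [::]); rewrite cats1.
case/lastP: s2 => [|s2 z]; first by rewrite cats1 => /rcons_inj[<- <-].
by rewrite -rcons_cons -rcons_cat => /rcons_inj[/Hs].
Qed.

Lemma in_rcons (s : seq X) x y :
  List.In y (rcons s x) <-> List.In y s \/ y = x.
Proof.
elim: s => [|z s IH] /=; first by split=> [[->|[]]|[[]|->]]; [right | left].
by rewrite IH; tauto.
Qed.

Lemma provable_ind_step (Q : X -> Prop) :
  (forall s x, (forall y, List.In y s -> Q y) -> step s x -> Q x) ->
  forall x, provable step x -> Q x.
Proof.
move=> HQ x [s Hs].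
suff HQs t : is_proof step t -> forall y, List.In y t -> Q y.
  by apply: HQs Hs _ _; apply/in_rcons; right.
elim/last_ind: t => [_ y []|t z IH /is_proof_rcons[/IH Ht Hz] y].
by case/in_rcons=> [/Ht //|->]; apply: HQ Hz.
Qed.

Hypothesis mono : step_mono.

Lemma is_proof_cat s t : is_proof step s -> is_proof step t -> is_proof step (s ++ t).
Proof.
move=> Hs; elim/last_ind: t => [|t z IH]; first by rewrite cats0.
case/is_proof_rcons=> /IH Ht Hz; rewrite -rcons_cat; apply/is_proof_rcons; split=> //.
by apply: mono Hz => y Hy; apply/List.in_app_iff; right.
Qed.

(** Proofs of the premises in [s] are concatenated and [x] is appended. With [provable_ind_step],
    this lets the rest of the development argue by rules instead of sequences. *)
Lemma provable_step s x :
  (forall y, List.In y s -> provable step y) -> step s x -> provable step x.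
Proof.
move=> Hs Hx; suff [t [Ht Hst]] : exists t, is_proof step t /\
    forall y, List.In y s -> List.In y t.
  by exists t; apply/is_proof_rcons; split=> //; apply: mono Hx.
elim: s Hs {Hx} => [_|y s IH Hs]; first by exists [::]; split=> // -[].
have [t [Ht Hst]] := IH (fun z Hz => Hs z (or_intror Hz)).
have [u Hu] := Hs y (or_introl erefl).
exists (rcons u y ++ t); split=> [|z]; first exact: is_proof_cat.
by move=> Hz; apply/List.in_app_iff; rewrite in_rcons; case: Hz => [->|/Hst]; tauto.
Qed.

End SequenceProofs.

(** * Derivations in the Łukasiewicz calculus *)

Section LukasiewiczTheory.
(** [P] is abstract because it is instantiated twice: by provability in RPL and by provability with
    grade 1 in GRPL. *)
Variable P : form -> Prop.
Hypothesis luk : forall a, luk_axiom a -> P a.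
Hypothesis mp : forall a b, P a -> P (Imp a b) -> P b.

Lemma luk_weaken a b : P a -> P (Imp b a).
Proof. by move=> Ha; apply: mp Ha (luk (A1 _ _)). Qed.

Lemma luk_trans b a c : P (Imp a b) -> P (Imp b c) -> P (Imp a c).
Proof. by move=> Hab Hbc; apply: mp Hbc (mp Hab (luk (A2 _ _ _))). Qed.

Lemma luk_apply a b : P (Imp a (Imp (Imp a b) b)).
Proof. exact: luk_trans (luk (A1 _ (Imp b a))) (luk (A3 _ _)). Qed.

Lemma luk_exchange a b c : P (Imp (Imp a (Imp b c)) (Imp b (Imp a c))).
Proof.
(* The middle formula is ((b -> c) -> c) -> (a -> c); its premise is then weakened to b by
   [luk_apply]. *)
apply: luk_trans (luk (A2 _ _ c)) _.
exact: mp (luk_apply b c) (luk (A2 _ _ _)).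
Qed.

Lemma luk_swap a b c : P (Imp a (Imp b c)) -> P (Imp b (Imp a c)).
Proof. by move=> H; apply: mp H (luk_exchange _ _ _). Qed.

Lemma luk_refl a : P (Imp a a).
(* Swapped, [A1] reads q -> (a -> a); any theorem serves as q. *)
Proof. exact: mp (luk (A1 a a)) (luk_swap (luk (A1 a _))). Qed.

Lemma luk_prefix a b c : P (Imp a b) -> P (Imp (Imp c a) (Imp c b)).
Proof. by move=> H; apply: mp H (luk_swap (luk (A2 _ _ _))). Qed.

Lemma luk_exfalso a b : P (Imp (Neg a) (Imp a b)).
Proof. exact: luk_trans (luk (A1 _ (Neg b))) (luk (A4 _ _)). Qed.

Lemma luk_dne a : P (Imp (Neg (Neg a)) a).
Proof.
(* From ~~a follows ~a -> ~(a -> a), which [A4] reverses; the theorem a -> a is then discharged. *)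
have H : P (Imp (Neg (Neg a)) (Imp (Imp a a) a)).
  exact: luk_trans (luk_exfalso _ (Neg (Imp a a))) (luk (A4 _ _)).
exact: mp (luk_refl a) (luk_swap H).
Qed.

Lemma luk_dni a : P (Imp a (Neg (Neg a))).
Proof. exact: mp (luk_dne (Neg a)) (luk (A4 _ _)). Qed.

Lemma luk_contra_imp a b : P (Imp (Imp a b) (Imp (Neg b) (Neg a))).
Proof.
apply: luk_trans (mp (luk_dne a) (luk (A2 _ _ b))) _.
exact: luk_trans (luk_prefix _ (luk_dni b)) (luk (A4 _ _)).
Qed.

Lemma luk_contra a b : P (Imp a b) -> P (Imp (Neg b) (Neg a)).
Proof. by move=> H; apply: mp H (luk_contra_imp _ _). Qed.

(** [Odot a b] unfolds to ~(~~a -> ~b), so ~~a turns the negated implication's contrapositive into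
    ~~b -> [Odot a b]. *)
Lemma luk_odot_intro a b : P a -> P b -> P (Odot a b).
Proof.
move=> Ha Hb; have Hnna := mp Ha (luk_dni a).
exact: mp (mp Hb (luk_dni b)) (luk_contra (mp Hnna (luk_apply _ _))).
Qed.

Lemma luk_odot_elim a b : P (Odot a b) -> P a /\ P b.
Proof.
move=> H; split.
  have Ha := luk_contra (luk_swap (luk_exfalso (Neg a) (Neg b))).
  exact: mp (mp H Ha) (luk_dne a).
exact: mp (mp H (luk_contra (luk (A1 _ _)))) (luk_dne b).
Qed.

(** The second factor of [And] is an implication from the first, hence the weakening here and the
    detachment in [luk_equ_elim]. *)
Lemma luk_equ_intro a b : P (Imp a b) -> P (Imp b a) -> P (Equ a b).
Proof. by move=> Hab Hba; apply: luk_odot_intro => //; apply: luk_weaken. Qed.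

Lemma luk_equ_elim a b : P (Equ a b) -> P (Imp a b) /\ P (Imp b a).
Proof. by case/luk_odot_elim=> Hab H; split=> //; apply: mp Hab H. Qed.

(** Contraposing b -> c and swapping gives ~c -> (a -> ~b), and a second contraposition
    concludes. *)
Lemma luk_residuation a b c :
  P (Imp a (Imp b c)) -> P (Imp (Neg (Imp a (Neg b))) c).
Proof.
move=> H; have H' := luk_trans H (luk_contra_imp b c).
exact: luk_trans (luk_contra (luk_swap H')) (luk_dne c).
Qed.

End LukasiewiczTheory.

Lemma luk_neg1 : luk_neg urat1 = urat0.
Proof. exact: val_inj. Qed.

Lemma luk_conj11 : luk_conj urat1 urat1 = urat1.
Proof. exact: val_inj. Qed.

(** The bookkeeping axioms speak of implication and negation only, so the grade produced by graded
    modus ponens is rewritten through these. *)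
Lemma luk_neg_imp_neg q r : luk_neg (luk_imp q (luk_neg r)) = luk_conj q r.
Proof.
apply: val_inj; case: q r => [q /= _] [r /= _].
by rewrite /Num.max /Num.min; do 2![case: ifP => /negP ?]; lra.
Qed.

Lemma rpl_step_mono T : step_mono (rpl_step T).
Proof.
move=> s1 s2 x s12; case=> [a Ha|a Ha|a b /s12 Ha /s12 Hab].
- exact: RPL_ax.
- exact: RPL_hyp.
- exact: RPL_mp Ha Hab.
Qed.

Lemma grpl_step_mono T : step_mono (grpl_step T).
Proof.
move=> s1 s2 x s12; case=> [g Hg|g Hg|q r a b /s12 Ha /s12 Hab|q r a /s12 Ha].
- exact: GRPL_ax.
- exact: GRPL_hyp.
- exact: GRPL_mp Ha Hab.
- exact: GRPL_lift.
Qed.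

(** * Reading graded formulas inside RPL *)

Section RplProvable.
Variable T : set form.

Lemma rpl_provable_axiom a : rpl_axiom a -> rpl_provable T a.
Proof.
by move=> Ha; apply: (provable_step (@rpl_step_mono T) (s := [::])) => //; apply: RPL_ax.
Qed.

Lemma rpl_provable_hyp a : T a -> rpl_provable T a.
Proof.
by move=> Ha; apply: (provable_step (@rpl_step_mono T) (s := [::])) => //; apply: RPL_hyp.
Qed.

Lemma rpl_provable_mp a b :
  rpl_provable T a -> rpl_provable T (Imp a b) -> rpl_provable T b.
Proof.
move=> Ha Hab; apply: (provable_step (@rpl_step_mono T) (s := [:: a; Imp a b])).
  by move=> c /= [<-|[<-|[]]].
by apply: (@RPL_mp _ _ a) => /=; tauto.
Qed.

Let luk a (Ha : luk_axiom a) := rpl_provable_axiom (RPL_luk Ha).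
Let mp := rpl_provable_mp.

Lemma rpl_const1 : rpl_provable T (Const urat1).
Proof.
have [_ H] := luk_equ_elim luk mp (rpl_provable_axiom RPL_one).
exact: mp (luk_refl luk mp _) H.
Qed.

(** This handles the axioms (D), of grade 0. It holds because [Zero] negates a theorem. *)
Lemma rpl_const0_imp a : rpl_provable T (Imp (Const urat0) a).
Proof.
have [H _] := luk_equ_elim luk mp (rpl_provable_axiom RPL_zero).
apply: (luk_trans luk mp H).
exact: mp (luk_refl luk mp _) (luk_swap luk mp (luk_exfalso luk mp One a)).
Qed.

Lemma rpl_const_conj q r :
  rpl_provable T
    (Imp (Const (luk_conj q r)) (Neg (Imp (Const q) (Neg (Const r))))).
Proof.
rewrite -luk_neg_imp_neg.
have [_ Hneg] := luk_equ_elim luk mp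
  (rpl_provable_axiom (RPL_neg (luk_imp q (luk_neg r)))).
have [Himp _] := luk_equ_elim luk mp (rpl_provable_axiom (RPL_imp q (luk_neg r))).
have [Hr _] := luk_equ_elim luk mp (rpl_provable_axiom (RPL_neg r)).
apply: (luk_trans luk mp Hneg); apply: (luk_contra luk mp).
exact: (luk_trans luk mp (luk_prefix luk mp _ Hr) Himp).
Qed.

Lemma grpl_to_rpl g :
  grpl_provable [set (urat1, psi) | psi in T] g ->
  rpl_provable T (Imp (Const g.1) g.2).
Proof.
apply: (provable_ind_step (Q := fun g => rpl_provable T (Imp (Const g.1) g.2)))
  => {g} s g IH.
case=> {g} [g Hg|g [a Ta <-]|q r a b /IH /= Ha /IH /= Hab|q r a /IH /= Ha] /=.
- case: Hg => [{}g [a Ha|q|q|q r]|a _] /=.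
  + exact/(luk_weaken luk mp)/luk.
  + exact: luk_refl luk mp _.
  + exact/(luk_weaken luk mp)/rpl_provable_axiom/RPL_neg.
  + exact/(luk_weaken luk mp)/rpl_provable_axiom/RPL_imp.
  + exact: rpl_const0_imp.
- exact/(luk_weaken luk mp)/rpl_provable_hyp.
(* From q -> a and a -> (r -> b) comes q -> (r -> b), which is residuated. *)
- apply: (luk_trans luk mp (rpl_const_conj q r)).
  apply/(luk_residuation luk mp)/(luk_trans luk mp Ha).
  exact (luk_swap luk mp Hab).
- have [_ H] := luk_equ_elim luk mp (rpl_provable_axiom (RPL_imp r q)).
  exact (luk_trans luk mp H (luk_prefix luk mp _ Ha)).
Qed.

End RplProvable.

(** * The formulas provable in GRPL with grade 1 *)

Section GrplProvable.
Variable T : set gform.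

Lemma grpl_provable_axiom g : grpl_axiom_ABC g -> grpl_provable T g.
Proof.
move=> Hg; apply: (provable_step (@grpl_step_mono T) (s := [::])) => //.
exact/GRPL_ax/GRPL_ABC.
Qed.

Lemma grpl_provable_hyp g : T g -> grpl_provable T g.
Proof.
by move=> Hg; apply: (provable_step (@grpl_step_mono T) (s := [::])) => //; apply: GRPL_hyp.
Qed.

Lemma grpl_provable_mp1 a b :
  grpl_provable T (urat1, a) -> grpl_provable T (urat1, Imp a b) ->
  grpl_provable T (urat1, b).
Proof.
move=> Ha Hab.
apply: (provable_step (@grpl_step_mono T) (s := [:: (urat1, a); (urat1, Imp a b)])).
  by move=> c /= [<-|[<-|[]]].
set s := [:: _; _]; have := @GRPL_mp T s urat1 urat1 a b.
by rewrite luk_conj11; apply=> /=; tauto.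
Qed.

Let luk a (Ha : luk_axiom a) := grpl_provable_axiom (GRPL_A Ha).
Let mp := grpl_provable_mp1.

Lemma grpl_rpl_axiom a : rpl_axiom a -> grpl_provable T (urat1, a).
Proof.
have H1 := grpl_provable_axiom (GRPL_B urat1).
have HOne := luk_refl (P := fun a => grpl_provable T (urat1, a)) luk mp (Var 0).
case=> {a} [a|q r|q||].
- exact: luk.
- exact/grpl_provable_axiom/GRPL_C_imp.
- exact/grpl_provable_axiom/GRPL_C_neg.
(* Both sides are theorems of grade 1. *)
- by apply: (luk_equ_intro luk mp); apply: (luk_weaken luk mp).
(* The constant 0 is equivalent to the negated constant 1, and [Zero] is ~[One]; contraposition
   reduces this case to the equivalence of the constant 1 with [One]. *)
- have := grpl_provable_axiom (GRPL_C_neg urat1); rewrite luk_neg1.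
  case/(luk_equ_elim luk mp)=> H10 H01.
  apply: (luk_equ_intro luk mp).
    exact: (luk_trans luk mp H01 (luk_contra luk mp (luk_weaken luk mp _ H1))).
  exact: (luk_trans luk mp (luk_contra luk mp (luk_weaken luk mp _ HOne)) H10).
Qed.

End GrplProvable.

Theorem corollary4p5 (T : set form) (phi : form) :
  rpl_provable T phi <->
  grpl_provable [set (urat1, psi) | psi in T] (urat1, phi).
Proof.
(* Backwards, the constant 1 implies [phi] in RPL and is itself a theorem there. *)
split=> [|/grpl_to_rpl /=]; last exact/rpl_provable_mp/rpl_const1.
apply: (provable_ind_step
  (Q := fun a => grpl_provable [set (urat1, psi) | psi in T] (urat1, a)))
  => s _ IH [a Ha|a Ta|a b /IH Ha /IH Hab].
- exact: grpl_rpl_axiom.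
- by apply: grpl_provable_hyp; exists a.
- exact: grpl_provable_mp1 Ha Hab.
Qed.
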